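(* Let $\{x,y\}$ be a true pair in a graph $G$. Then $\operatorname{reg}(G)=\operatorname{reg}(\mathfrak{g}(G;xy))$.
   Context: $\operatorname{reg}(G)=\max\{j\ge0:\widetilde H_{j-1}(\operatorname{Ind}(G[S]);\Bbbk)\neq0\text{ for some }S\subseteq V(G)\}$ over a field $\Bbbk$, $\operatorname{Ind}$ the independence complex. A genuine pair in $G$ is a pair of distinct non-adjacent vertices $x,y$ such that there are no vertices $u,v\in V(G)\setminus\{x,y\}$ with $G[\{x,y,u,v\}]$ isomorphic to $2K_2$ (two disjoint edges). For a genuine pair, $\mathfrak{g}(G;xy)$ is the graph obtained from $G-\{x,y\}$ by adding a new vertex $w$ adjacent exactly to the vertices of $N_G(x)\cap N_G(y)$. A genuine pair $\{x,y\}$ is a true pair if there is a vertex $u\in N_G(x)\cap N_G(y)$ with $N_G[u]\subseteq N_G[x]\cup N_G[y]$. *)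

(* Defs.v *)
From HB Require Import structures.
From mathcomp Require Import all_boot all_order all_algebra.
Set Implicit Arguments. Unset Strict Implicit. Unset Printing Implicit Defensive.
Import GRing.Theory.
Local Open Scope ring_scope.

Section Graphs.
Variable T : finType.

Definition simple_graph (e : rel T) : Prop := symmetric e /\ irreflexive e.

Definition Ind (e : rel T) (S : {set T}) : {set {set T}} :=
  [set s : {set T} | (s \subset S) && [forall u in s, forall v in s, ~~ e u v]].

Definition faces (D : {set {set T}}) (n : nat) : {set {set T}} :=
  [set s in D | #|s| == n].

(* Coefficient of tau in the boundary of sigma, vertices ordered by enum_rank:
   if sigma = tau + {v}, it is (-1)^(number of vertices of sigma below v). *)
Definition bdcoef (K : fieldType) (sigma tau : {set T}) : K :=
  if (tau \subset sigma) && (#|sigma| == #|tau|.+1) then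
    (-1) ^+ (\sum_(v in sigma :\: tau)
               #|[set u in sigma | enum_rank u < enum_rank v]|)%N
  else 0.

(* Simplicial boundary map from (n-1)-chains to (n-2)-chains, as a matrix
   acting on row vectors; rows indexed by faces of size n, columns by faces
   of size n-1 (augmented: for n = 1 it maps to the empty face, for n = 0
   it is the zero map). *)
Definition bd (K : fieldType) (D : {set {set T}}) (n : nat)
  : 'M[K]_(#|faces D n|, #|faces D n.-1|) :=
  \matrix_(i, j) bdcoef K (enum_val i) (enum_val j).

(* Reduced homology H~_{n-1}(D; K) is nonzero: ker bd_n is not contained
   in im bd_{n+1}. *)
Definition redH_nonzero (K : fieldType) (D : {set {set T}}) (n : nat) : bool :=
  ~~ (kermx (bd K D n) <= bd K D n.+1)%MS.

(* reg(G) = max { j >= 0 : H~_{j-1}(Ind(G[S]); K) <> 0 for some S }.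
   Such j satisfy j <= #|T| (there are no faces of size > #|T|), so the
   bounded max below is the max over all j. *)
Definition reg (K : fieldType) (e : rel T) : nat :=
  \max_(j < #|T|.+2 | [exists S : {set T}, redH_nonzero K (Ind e S) j]) j.

Definition induced_2K2 (e : rel T) (W : {set T}) : Prop :=
  #|W| = 4%N /\
  exists a b c d, W = [set a; b; c; d] /\ e a b /\ e c d /\
    ~~ e a c /\ ~~ e a d /\ ~~ e b c /\ ~~ e b d.

Definition genuine_pair (e : rel T) (x y : T) : Prop :=
  x != y /\ ~~ e x y /\
  forall u v, u \notin [set x; y] -> v \notin [set x; y] ->
    ~ induced_2K2 e [set x; y; u; v].

Definition nbhd (e : rel T) (v : T) : {set T} := [set u | e v u].
Definition cnbhd (e : rel T) (v : T) : {set T} := v |: nbhd e v.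

Definition true_pair (e : rel T) (x y : T) : Prop :=
  genuine_pair e x y /\
  exists u, u \in nbhd e x :&: nbhd e y /\
    cnbhd e u \subset cnbhd e x :|: cnbhd e y.

(* g(G;xy): vertices are Some v for v in V(G) \ {x,y}, and the new vertex
   w = None, adjacent exactly to N(x) ∩ N(y). *)
Definition gedge (e : rel T) (x y : T)
  : rel (option {v : T | (v != x) && (v != y)}) :=
  fun a b =>
    match a, b with
    | Some a', Some b' => e (val a') (val b')
    | None, Some b' => e x (val b') && e y (val b')
    | Some a', None => e x (val a') && e y (val a')
    | None, None => false
    end.

End Graphs.
Arguments gedge {T} e x y.

(* Main.v *)
(** Contracting the edge [xy] of [Ind G] replaces the links of [x] and [y] by their
    union.  For a genuine pair every private neighbour of [x] is adjacent to every
    private neighbour of [y], so this union consists of the independent sets avoiding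
    [N(x) ∩ N(y)], i.e. the contraction is [Ind (g(G;xy))] and has the same homology.
    Applied to induced subgraphs, this matches those containing [x] and [y] with
    those of [g(G;xy)] containing [w]; a true pair allows one to trade a subgraph
    containing exactly one of [x], [y] for one containing both or neither.  The
    contraction is done in two steps, each discarding a set of faces that is stable
    under adding and removing a fixed vertex, hence homologically invisible. *)

Require Import Defs.
From HB Require Import structures.
From mathcomp Require Import all_boot all_order all_algebra.
Set Implicit Arguments. Unset Strict Implicit. Unset Printing Implicit Defensive.
Import GRing.Theory.
Local Open Scope ring_scope.

(** * Set families, and chains over an arbitrary injective ranking of the vertices *)

Definition downset (T : finType) (D : {set {set T}}) : Prop :=
  forall s t : {set T}, t \subset s -> s \in D -> t \in D.

Definition deletion (T : finType) (D : {set {set T}}) (v : T) : {set {set T}} :=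
  [set s in D | v \notin s].

Definition link (T : finType) (D : {set {set T}}) (v : T) : {set {set T}} :=
  [set s : {set T} | (v \notin s) && (v |: s \in D)].

Section Chains.
Variables (K : fieldType) (T : finType) (r : T -> nat).
Hypothesis r_inj : injective r.

Implicit Types (v w : T) (s t : {set T}) (c a b : {ffun {set T} -> K}).
Implicit Types (D E : {set {set T}}) (n : nat).

Definition sgn s v : K := (-1) ^+ #|[set u in s | (r u < r v)%N]|.

(** Chains are functions on all vertex sets, with faces entering only through support conditions, so
    a single operator serves every complex. *)
Definition bnd c : {ffun {set T} -> K} :=
  [ffun s : {set T} => \sum_(v | v \notin s) sgn s v * c (v |: s)].

(** Exterior multiplication by [v], that is, coning with apex [v]; [contr] is the matching interior
    product. *)
Definition wedge v c : {ffun {set T} -> K} :=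
  [ffun s : {set T} => if v \in s then sgn s v * c (s :\ v) else 0].

Definition contr v c : {ffun {set T} -> K} :=
  [ffun s : {set T} => if v \in s then 0 else sgn s v * c (v |: s)].

Definition restr D c : {ffun {set T} -> K} :=
  [ffun s : {set T} => if s \in D then c s else 0].

Definition supported D c : Prop := forall s : {set T}, s \notin D -> c s = 0.

(** Faces are graded by size, so for a down-closed [D] this is the vanishing of reduced homology in
    degree [n] - 1. *)
Definition acyclic D n : Prop :=
  forall c, supported (faces D n) c -> bnd c = 0 ->
  exists2 b, supported (faces D n.+1) b & bnd b = c.

Lemma sgnU1 s v w : v \notin s ->
  sgn (v |: s) w = (if (r v < r w)%N then -1 else 1) * sgn s w.
Proof.
move=> vs; rewrite /sgn; case: ifP => vw.
- have -> : [set u in v |: s | (r u < r w)%N] =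
            v |: [set u in s | (r u < r w)%N].
    by apply/setP=> u; rewrite !inE; case: eqP => // ->; rewrite vw.
  by rewrite cardsU1 inE (negPf vs) exprS.
- rewrite mul1r; congr (_ ^+ _).
  by apply: eq_card => u; rewrite !inE; case: eqP => // ->; rewrite vw !andbF.
Qed.

Lemma sgn_self s v : sgn (v |: s) v = sgn s v.
Proof.
rewrite /sgn; congr (_ ^+ _).
by apply: eq_card => u; rewrite !inE; case: eqP => // ->; rewrite ltnn !andbF.
Qed.

Lemma sgnK s v : sgn s v * sgn s v = 1.
Proof. by rewrite -expr2 sqrr_sign. Qed.

Lemma sgn_swap s v w : v != w -> v \notin s -> w \notin s ->
  sgn s v * sgn (v |: s) w = - (sgn s w * sgn (w |: s) v).
Proof.
move=> vw vs ws; rewrite !sgnU1 //.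
have: r v != r w by apply: contra vw => /eqP/r_inj ->.
by case: ltngtP => // _ _; rewrite ?mul1r ?mulN1r mulrN ?opprK mulrC.
Qed.

Lemma bndD a b : bnd (a + b) = bnd a + bnd b.
Proof.
apply/ffunP=> s; rewrite !ffunE -big_split /=.
by apply: eq_bigr => v _; rewrite ffunE mulrDr.
Qed.

Lemma bndN a : bnd (- a) = - bnd a.
Proof.
apply/ffunP=> s; rewrite !ffunE -sumrN.
by apply: eq_bigr => v _; rewrite ffunE mulrN.
Qed.

Lemma bndB a b : bnd (a - b) = bnd a - bnd b.
Proof. by rewrite bndD bndN. Qed.

Lemma bnd0 : bnd 0 = 0.
Proof. by rewrite -[in LHS](subrr (0 : {ffun _ -> K})) bndB subrr. Qed.

Lemma wedgeN v a : wedge v (- a) = - wedge v a.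
Proof.
by apply/ffunP=> s; rewrite !ffunE; case: ifP; rewrite ?oppr0 // mulrN.
Qed.

Lemma wedge0 v : wedge v 0 = 0.
Proof. by apply/ffunP=> s; rewrite !ffunE mulr0 if_same. Qed.

(** Coning is a contracting homotopy of the full simplex: removing [v] again gives back [c], and
    removing any other vertex anticommutes with adding [v]. *)
Lemma bnd_wedge v c : bnd (wedge v c) = c - wedge v (bnd c).
Proof.
apply/ffunP=> s; rewrite !ffunE; case: ifPn => vs.
- have [p vp ->] : exists2 p : {set T}, v \notin p & s = v |: p.
    by exists (s :\ v); rewrite ?setD1K // !inE eqxx.
  rewrite setU1K // sgn_self.
  rewrite [X in _ = _ - _ * X](bigD1 v) //= mulrDr mulrA sgnK mul1r.
  rewrite opprD addrA subrr sub0r mulr_sumr -sumrN.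
  apply: eq_big => [w|w]; first by rewrite !inE negb_or andbC.
  rewrite !inE negb_or => /andP[wv wp].
  rewrite !ffunE !inE eqxx orbT.
  have -> : (w |: (v |: p)) :\ v = w |: p.
    apply/setP=> z; rewrite !inE; case: (eqVneq z v) => //= ->.
    by rewrite (negPf vp) eq_sym (negPf wv).
  rewrite setUCA sgn_self !sgnU1 //.
  have: r v != r w by apply: contra wv => /eqP/r_inj ->.
  case: ltngtP => // _ _; rewrite !(mul1r, mulN1r, mulNr, mulrN);
    by rewrite mulrCA.
- rewrite (bigD1 v) //= big1 => [|w /andP[ws wv]].
    by rewrite !ffunE setU11 setU1K // sgn_self mulrA sgnK mul1r addr0 subr0.
  by rewrite !ffunE !inE (negPf vs) orbF eq_sym (negPf wv) mulr0.
Qed.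

(** The terms at [(v, w)] and [(w, v)] cancel after sorting by [r]. The zero diagonal is a separate
    assumption because antisymmetry does not imply it in characteristic 2. *)
Lemma sum_antisym (F : T -> T -> K) :
  (forall v, F v v = 0) -> (forall v w, F v w = - F w v) ->
  \sum_v \sum_w F v w = 0.
Proof.
move=> F0 FN.
have -> : \sum_v \sum_w F v w = \sum_v \sum_(w | (r v < r w)%N) F v w
                              + \sum_v \sum_(w | (r w < r v)%N) F v w.
  rewrite -big_split; apply: eq_bigr => v _.
  rewrite (bigID (fun w => (r v < r w)%N)) /=; congr (_ + _).
  rewrite (bigD1 v) ?ltnn //= F0 add0r; apply: eq_bigl => w.
  rewrite -leqNgt ltn_neqAle andbC; congr (~~ _ && _).
  by apply/eqP/eqP=> [->|/r_inj].
rewrite [X in _ + X](exchange_big_dep predT) //= -big_split big1 // => v _.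
by rewrite -big_split big1 // => w _; rewrite /= FN addNr.
Qed.

Lemma bnd_bnd c : bnd (bnd c) = 0.
Proof.
apply/ffunP=> s; rewrite !ffunE.
pose F v w := if [&& v \notin s, w \notin s & v != w]
  then sgn s v * (sgn (v |: s) w * c (w |: (v |: s))) else 0.
rewrite -[RHS](@sum_antisym F).
- rewrite big_mkcond; apply: eq_bigr => v _; rewrite /F.
  case: ifPn => vs /=; last by rewrite big1.
  rewrite ffunE mulr_sumr big_mkcond; apply: eq_bigr => w _.
  by rewrite !inE negb_or andbC [w == v]eq_sym.
- by move=> v; rewrite /F eqxx !andbF.
- move=> v w; rewrite /F.
  case: (boolP (v \in s)) => vs; first by rewrite andbF oppr0.
  case: (boolP (w \in s)) => ws; first by rewrite oppr0.
  rewrite eq_sym; case: eqVneq => /= [|wv]; first by rewrite oppr0.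
  by rewrite !mulrA sgn_swap 1?eq_sym // mulNr setUCA.
Qed.

Lemma supportedD D a b : supported D a -> supported D b -> supported D (a + b).
Proof. by move=> Da Db s sD; rewrite ffunE Da // Db // addr0. Qed.

Lemma supportedN D a : supported D a -> supported D (- a).
Proof. by move=> Da s sD; rewrite ffunE Da // oppr0. Qed.

Lemma supported0 D : supported D (0 : {ffun {set T} -> K}).
Proof. by move=> s _; rewrite ffunE. Qed.

Lemma supported_sub D E a : D \subset E -> supported D a -> supported E a.
Proof.
by move=> /subsetP DE Da s sE; apply: Da; apply: contra sE; apply: DE.
Qed.

Lemma facesS D E n : D \subset E -> faces D n \subset faces E n.
Proof. by move=> /subsetP DE; apply/subsetP=> s; rewrite !inE => /andP[/DE-> ->]. Qed.

Lemma bnd_supported D n c : downset D ->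
  supported (faces D n.+1) c -> supported (faces D n) (bnd c).
Proof.
move=> dD Dc s sD; rewrite ffunE big1 // => v vs.
rewrite Dc ?mulr0 //; apply: contra sD; rewrite !inE cardsU1 vs eqSS.
by case/andP=> /(dD _ _ (subsetUr _ _)) -> ->.
Qed.

Lemma bnd_faces0 D c : supported (faces D 0) c -> bnd c = 0.
Proof.
move=> Dc; apply/ffunP=> s; rewrite !ffunE big1 // => v vs.
by rewrite Dc ?mulr0 // !inE cardsU1 vs andbF.
Qed.

(** * Discarding faces that are stable under toggling a vertex *)

Section Toggle.
Variables (D E : {set {set T}}) (v : T).
Hypotheses (dD : downset D) (dE : downset E) (DE : D \subset E).
Hypothesis toggle : forall s, s \in E :\: D ->
  (v |: s \in E :\: D) && (s :\ v \in E :\: D).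

(* Subtracting the boundary of the cone over the part outside [D] pushes a chain
   of [E] whose boundary lies in [D] into [D]. *)
Lemma toggle_push n b :
  supported (faces E n) b -> supported D (bnd b) ->
  let q := wedge v (restr (E :\: D) b) in
  supported (faces E n.+1) q /\ supported (faces D n) (b - bnd q).
Proof.
move=> Eb Db q.
set p := restr (E :\: D) b in q *.
have Eq : supported (faces E n.+1) q.
  move=> s sE; rewrite !ffunE; case: ifPn => // vs; case: ifP => [sv|]; rewrite ?mulr0 //.
  rewrite Eb ?mulr0 //; apply: contra sE; rewrite !inE => /andP[_ nn].
  case/andP: (toggle sv); rewrite setD1K // inE => /andP[_ ->] _ /=.
  by rewrite (cardsD1 v) vs eqSS.
split=> //.
have Dbp : supported D (b - p).
  move=> s sD; rewrite !ffunE inE sD /=; case: ifPn => [_|sE]; first by rewrite subrr.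
  by rewrite Eb ?subr0 // inE (negPf sE).
(* Both [bnd b] and [bnd (b - p)] live in [D], the latter because [D] is down-closed. *)
have Dp : supported D (bnd p).
  have -> : bnd p = bnd b - bnd (b - p) by rewrite bndB subKr.
  apply: supportedD => //; apply: supportedN => s sD.
  rewrite ffunE big1 // => w _; rewrite Dbp ?mulr0 //.
  by apply: contra sD; apply: dD; apply: subsetUr.
have E1 : supported (faces E n) (b - bnd q).
  by apply: supportedD => //; apply: supportedN; apply: bnd_supported.
(* Here [b - bnd q] equals [(b - p) + wedge v (bnd p)]. The first term vanishes off [D]; the second
   evaluates [bnd p] at [s :\ v], which is still outside [D] by toggling. *)
have E2 s : s \in E :\: D -> (b - bnd q) s = 0.
  move=> sED; rewrite bnd_wedge // opprB addrCA addrC ffunE.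
  case/andP: (toggle sED) => _; rewrite inE => /andP[svD _].
  rewrite [X in X + _]Dbp; last by move: sED; rewrite inE => /andP[].
  by rewrite add0r ffunE; case: ifP => // _; rewrite Dp ?mulr0.
move=> s sD; case: (boolP (s \in E :\: D)) => [/E2 //|sED].
apply: E1; move: sD sED; rewrite !inE.
by case: (s \in D); case: (s \in E); case: (#|s| == n).
Qed.

(** From [D] to [E], the cycle itself is pushed into [D] and filled there; from [E] to [D], a
    filling found in [E] is pushed into [D]. *)
Lemma toggle_acyclic n : acyclic D n <-> acyclic E n.
Proof.
split=> acy c cS cC.
- have [|Eq Dc] := toggle_push cS; first by rewrite cC; apply: supported0.
  case: (acy _ Dc) => [|b Db bE]; first by rewrite bndB cC bnd_bnd // subr0.
  set q := wedge _ _ in Eq bE.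
  exists (b + q); last by rewrite bndD bE subrK.
  by apply: supportedD => //; apply: supported_sub Db; apply: facesS.
- have [||b Eb bE] := acy c; [exact: supported_sub (facesS _ DE) cS|by []|].
  have [|Eq Db] := toggle_push Eb.
    by rewrite bE => s sD; apply: cS; rewrite inE (negPf sD).
  by exists (b - bnd (wedge v (restr (E :\: D) b))); rewrite // bndB bnd_bnd // subr0.
Qed.
End Toggle.

(** * The long exact sequence of deletion and link *)

Definition avoids v c : Prop := forall s : {set T}, v \in s -> c s = 0.

Lemma avoids_bnd v a : avoids v a -> avoids v (bnd a).
Proof.
move=> va s vs; rewrite ffunE big1 // => w _.
by rewrite va ?mulr0 // inE vs orbT.
Qed.

Lemma wedge_decomp v c :
  c = restr [set s : {set T} | v \notin s] c + wedge v (contr v c).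
Proof.
apply/ffunP=> s; rewrite !ffunE !inE; case: ifPn => vs.
  by rewrite (negPf vs) addr0.
rewrite eqxx /= negbK in vs *; rewrite vs add0r setD1K //.
by rewrite -{2}(setD1K vs) sgn_self mulrA sgnK mul1r.
Qed.

Lemma wedge_eq0 v a b : avoids v a -> avoids v b -> a + wedge v b = 0 ->
  a = 0 /\ b = 0.
Proof.
move=> va vb /ffunP ab.
have a0 : a = 0.
  apply/ffunP=> s; case: (boolP (v \in s)) => vs; first by rewrite va // ffunE.
  by have := ab s; rewrite !ffunE (negPf vs) addr0.
split=> //; apply/ffunP=> s; case: (boolP (v \in s)) => vs.
  by rewrite vb // ffunE.
have := ab (v |: s); rewrite a0 !ffunE add0r setU11 setU1K // sgn_self.
by move/(congr1 ( *%R (sgn s v))); rewrite mulrA sgnK mul1r mulr0.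
Qed.

Lemma face_decomp D n v c : supported (faces D n.+1) c ->
  exists a b, [/\ supported (faces (deletion D v) n.+1) a,
    supported (faces (link D v) n) b & c = a + wedge v b].
Proof.
move=> Dc; move: (wedge_decomp v c) => cE; do 2!eexists; split; last exact: cE.
- move=> s; rewrite !ffunE !inE -andbA.
  by case: (v \in s) => //= sD; apply: Dc; rewrite inE.
- move=> s; rewrite !ffunE !inE; case: ifPn => //= vs sD.
  by rewrite Dc ?mulr0 // !inE cardsU1 vs eqSS.
Qed.

Lemma avoids_deletion D n v a :
  supported (faces (deletion D v) n) a -> avoids v a.
Proof. by move=> Da s vs; apply: Da; rewrite !inE vs andbF. Qed.

Lemma avoids_link D n v a : supported (faces (link D v) n) a -> avoids v a.
Proof. by move=> Da s vs; apply: Da; rewrite !inE vs. Qed.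

Lemma wedge_supported D n v b : supported (faces (link D v) n) b ->
  supported (faces D n.+1) (wedge v b).
Proof.
move=> Lb s sD; rewrite ffunE; case: ifP => // vs; rewrite Lb ?mulr0 //.
apply: contra sD; rewrite !inE eqxx /= setD1K // => /andP[-> /eqP <-].
by rewrite (cardsD1 v) vs add1n eqxx.
Qed.

Lemma deletion_sub D v : deletion D v \subset D.
Proof. by apply/subsetP=> s; rewrite inE => /andP[]. Qed.

Lemma link_sub_deletion D v : downset D -> link D v \subset deletion D v.
Proof.
move=> dD; apply/subsetP=> s; rewrite !inE => /andP[-> /(dD _ _ (subsetUr _ _)) ->].
by [].
Qed.

(** In the coordinates given by deletion part and link part, the boundary is that of the mapping
    cone of the inclusion of the link into the deletion. *)
Lemma bnd_decomp v a b : avoids v a -> avoids v b ->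
  [/\ bnd (a + wedge v b) = (bnd a + b) + wedge v (- bnd b),
      avoids v (bnd a + b) & avoids v (- bnd b)].
Proof.
move=> va vb; split; first by rewrite bndD bnd_wedge // wedgeN addrA.
  by move=> s vs; rewrite ffunE (avoids_bnd va vs) vb // addr0.
by move=> s vs; rewrite ffunE (avoids_bnd vb vs) oppr0.
Qed.

(** Exactness at [D]: filling the link part of a cycle allows the cycle to be moved off [v]. *)
Lemma acyclic_of_deletion_link D v n : downset D ->
  acyclic (deletion D v) n.+1 -> acyclic (link D v) n -> acyclic D n.+1.
Proof.
move=> dD acyD acyL c Dc cC.
have [a [b [Da Lb cE]]] := face_decomp v Dc.
have va := avoids_deletion Da; have vb := avoids_link Lb.
have [bE v1 v2] := bnd_decomp va vb.
have [_ /eqP] : bnd a + b = 0 /\ - bnd b = 0.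
  by apply: (wedge_eq0 v1 v2); rewrite -bE -cE.
rewrite oppr_eq0 => /eqP b0.
have [d Ld dE] := acyL _ Lb b0.
(* Adding the boundary of [wedge v d] to [c] cancels the link part and leaves [a + d], a cycle of
   the deletion. *)
have [||f Df fE] := acyD (a + d).
- apply: supportedD => //; apply: supported_sub Ld.
  exact/facesS/link_sub_deletion.
- have -> : a + d = c + bnd (wedge v d).
    by rewrite bnd_wedge // dE cE addrA addrAC addrK.
  by rewrite bndD cC bnd_bnd // addr0.
exists (f - wedge v d).
  apply: supportedD; first exact: supported_sub (facesS _ (deletion_sub _ _)) Df.
  exact/supportedN/wedge_supported.
by rewrite bndB fE bnd_wedge // dE cE opprB addrA addrAC addrK.
Qed.

(** Exactness at the deletion: a filling of [c] in [D] has a link part [d] that is a cycle, and a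
    filling of [d] in the link replaces the cone over [d]. *)
Lemma acyclic_deletion D v n : downset D ->
  acyclic D n -> acyclic (link D v) n -> acyclic (deletion D v) n.
Proof.
move=> dD acyD acyL c Dc cC.
have [||b Db bC] := acyD c; first exact: supported_sub (facesS _ (deletion_sub _ _)) Dc.
  by [].
have [a [d [Da Ld bE]]] := face_decomp v Db.
have va := avoids_deletion Da; have vd := avoids_link Ld.
have [bdE v1 v2] := bnd_decomp va vd.
have [H /eqP] : bnd a + d - c = 0 /\ - bnd d = 0.
  apply: (@wedge_eq0 v) => //.
    move=> s vs; rewrite ffunE v1 // ffunE (avoids_deletion Dc) //.
    by rewrite oppr0 addr0.
  by rewrite addrAC -bdE -bE bC subrr.
rewrite oppr_eq0 => /eqP d0.
have [f Lf fE] := acyL _ Ld d0.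
exists (a + f); last by rewrite bndD fE; apply/eqP; rewrite -subr_eq0 H.
apply: supportedD => //; apply: supported_sub Lf.
exact/facesS/link_sub_deletion.
Qed.

(** Exactness at the link, through the connecting map that reads off the link part. *)
Lemma acyclic_link D v n : downset D ->
  acyclic D n.+1 -> acyclic (deletion D v) n -> acyclic (link D v) n.
Proof.
move=> dD acyD acyL c Lc cC.
have [||a Da aC] := acyL c.
- apply: supported_sub Lc; exact/facesS/link_sub_deletion.
- by [].
(* The chain [a] and the cone over [c] both have boundary [c], so their difference is a cycle of
   [D]; the link part of its filling fills [c]. *)
have [||b Db bC] := acyD (a - wedge v c).
- apply: supportedD; first exact: supported_sub (facesS _ (deletion_sub _ _)) Da.
  exact/supportedN/wedge_supported.
- by rewrite bndB aC bnd_wedge // cC wedge0 subr0 subrr.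
have [a' [d [Da' Ld bE]]] := face_decomp v Db.
have va := avoids_deletion Da'; have vd := avoids_link Ld.
have [bdE v1 v2] := bnd_decomp va vd.
exists d => //.
have [_ H] : bnd a' + d - a = 0 /\ c - bnd d = 0.
  apply: (@wedge_eq0 v).
  - move=> s vs; rewrite ffunE v1 // ffunE (avoids_deletion Da) //.
    by rewrite oppr0 addr0.
  - by move=> s vs; rewrite ffunE v2 // (avoids_link Lc) // addr0.
  - have -> : wedge v (c - bnd d) = wedge v c + wedge v (- bnd d).
      apply/ffunP=> s; rewrite !ffunE; case: ifP => _; last by rewrite addr0.
      by rewrite -mulrDr.
    rewrite -[RHS](subrr (bnd b)) {1}bE bdE bC opprB.
    by rewrite [wedge v c + _]addrC addrACA [- a + _]addrC.
by apply/eqP; rewrite eq_sym -subr_eq0 H.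
Qed.

End Chains.

(** * Independence of the vertex order *)

Section ChangeOfOrder.
Variables (K : fieldType) (T : finType).
Implicit Types (r : T -> nat) (s : {set T}) (D : {set {set T}}).

(* The transition factor between the orientations of simplices induced by two
   orders of the vertices. *)
Definition inversion_sign r1 r2 s : K :=
  \prod_(u in s) \prod_(w in s)
    (if (r1 u < r1 w)%N && (r2 w < r2 u)%N then -1 else 1).

Lemma inversion_sign_neq0 r1 r2 s : inversion_sign r1 r2 s != 0.
Proof.
apply/prodf_neq0 => u _; apply/prodf_neq0 => w _.
by case: ifP; rewrite ?oppr_eq0 oner_eq0.
Qed.

Lemma sgn_prod r s v :
  sgn K r s v = \prod_(u in s) (if (r u < r v)%N then -1 else 1).
Proof.
rewrite -big_mkcondr /= /sgn -prodr_const.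
by apply: eq_bigl => u; rewrite inE.
Qed.

(** The new pairs are those of [v] with some [u] in [s]. Such a pair contributes -1 exactly when the
    two orders disagree on it, which is also when the factors of [u] in the two signs differ. *)
Lemma inversion_signU1 r1 r2 s v : injective r1 -> injective r2 -> v \notin s ->
  sgn K r2 s v * inversion_sign r1 r2 (v |: s) =
  inversion_sign r1 r2 s * sgn K r1 s v.
Proof.
move=> i1 i2 vs; rewrite /inversion_sign big_setU1 //= big_setU1 //= ltnn mul1r.
rewrite [X in _ * (_ * X)](eq_bigr (fun u =>
    (if (r1 u < r1 v)%N && (r2 v < r2 u)%N then -1 else 1) *
    \prod_(w in s) (if (r1 u < r1 w)%N && (r2 w < r2 u)%N then -1 else 1)));
  last by move=> u _; rewrite big_setU1.
rewrite big_split /= !sgn_prod.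
rewrite !mulrA [RHS]mulrC -!big_split /=.
apply: eq_bigr => u us; congr (_ * _).
have uv : u != v by apply: contraNneq vs => <-.
have: r1 u != r1 v by apply: contra uv => /eqP/i1 ->.
have: r2 u != r2 v by apply: contra uv => /eqP/i2 ->.
by do 2![case: ltngtP => //= _ _]; rewrite ?(mulr1, mul1r, mulrN1, opprK).
Qed.

Lemma acyclic_rank r1 r2 D n : injective r1 -> injective r2 ->
  acyclic K r1 D n -> acyclic K r2 D n.
Proof.
move=> i1 i2 acy c Dc cC.
pose tw (h : {set T} -> K) (a : {ffun {set T} -> K}) : {ffun {set T} -> K} :=
  [ffun s : {set T} => h s * a s].
pose g := inversion_sign r1 r2.
have twS h a E : supported E a -> supported E (tw h a).
  by move=> Ea s sE; rewrite ffunE Ea ?mulr0.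
have twB a : bnd r2 (tw g a) = tw g (bnd r1 a).
  apply/ffunP=> s; rewrite !ffunE mulr_sumr; apply: eq_bigr => v vs.
  by rewrite ffunE !mulrA inversion_signU1.
have twK a : tw (fun s => (g s)^-1) (tw g a) = a.
  by apply/ffunP=> s; rewrite !ffunE mulKf ?inversion_sign_neq0.
have twVK a : tw g (tw (fun s => (g s)^-1) a) = a.
  by apply/ffunP=> s; rewrite !ffunE mulVKf ?inversion_sign_neq0.
have [||b Db bE] := acy (tw (fun s => (g s)^-1) c); first exact: twS.
  rewrite -[LHS]twK -twB twVK cC.
  by apply/ffunP=> s; rewrite !ffunE mulr0.
by exists (tw g b); [exact: twS | rewrite twB bE twVK].
Qed.

End ChangeOfOrder.

(** * Transport along an injection of vertex sets *)

Section Relabel.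
Variables (K : fieldType) (T T' : finType) (f : T' -> T) (r : T -> nat).
Hypothesis f_inj : injective f.
Implicit Types (s : {set T}) (t : {set T'}).

Definition im_complex (D : {set {set T'}}) : {set {set T}} :=
  [set f @: (t : {set T'}) | t in D].

Definition push (c : {ffun {set T'} -> K}) : {ffun {set T} -> K} :=
  [ffun s : {set T} => if s \subset f @: setT then c (f @^-1: s) else 0].

Definition pull (c : {ffun {set T} -> K}) : {ffun {set T'} -> K} :=
  [ffun t : {set T'} => c (f @: t)].

Lemma preimK t : f @^-1: (f @: t) = t.
Proof. by apply/setP=> u; rewrite inE mem_imset. Qed.

Lemma sub_imsetT s : s \subset f @: setT -> f @: (f @^-1: s) = s.
Proof.
move=> /subsetP sT; apply/setP=> u; apply/imsetP/idP => [[w]|us].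
  by rewrite inE => ? ->.
by have /imsetP[w _ uE] := sT _ us; exists w; rewrite // inE -uE.
Qed.

Lemma pullK c : pull (push c) = c.
Proof. by apply/ffunP=> t; rewrite !ffunE imsetS ?subsetT // preimK. Qed.

Lemma im_faces D n t : (f @: t \in faces (im_complex D) n) = (t \in faces D n).
Proof.
rewrite !inE card_imset // mem_imset //.
exact: imset_inj.
Qed.

Lemma pull_supported D n c :
  supported (faces (im_complex D) n) c -> supported (faces D n) (pull c).
Proof. by move=> Dc t tD; rewrite ffunE Dc // im_faces. Qed.

Lemma push_supported D n c :
  supported (faces D n) c -> supported (faces (im_complex D) n) (push c).
Proof.
move=> Dc s sD; rewrite ffunE; case: ifP => // sT; apply: Dc.
by rewrite -im_faces sub_imsetT.
Qed.

Lemma pushK D n c : supported (faces (im_complex D) n) c -> push (pull c) = c.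
Proof.
move=> Dc; apply/ffunP=> s; rewrite !ffunE; case: ifPn => [sT|sT].
  by rewrite sub_imsetT.
rewrite Dc //; apply: contra sT; rewrite inE => /andP[/imsetP[t _ ->] _].
by rewrite imsetS ?subsetT.
Qed.

Lemma sgn_imset t u : sgn K r (f @: t) (f u) = sgn K (r \o f) t u.
Proof.
rewrite !sgn_prod big_imset //= => ? ? _ _; exact: f_inj.
Qed.

(** Ranking the source by [r \o f] makes the signs agree exactly, and vertices outside the image
    contribute zero. *)
Lemma bnd_push c : bnd r (push c) = push (bnd (r \o f) c).
Proof.
apply/ffunP=> s; rewrite !ffunE; case: ifPn => sT; last first.
  rewrite big1 // => v _; rewrite ffunE ifN ?mulr0 //.
  by apply: contra sT; apply: subset_trans; apply: subsetUr.
rewrite -(sub_imsetT sT); set t := f @^-1: s; rewrite preimK.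
rewrite (bigID (mem (f @: setT))) /= addrC big1 ?add0r; last first.
  move=> v /andP[_ vT]; rewrite ffunE ifN ?mulr0 //.
  by rewrite subUset sub1set (negPf vT).
rewrite (eq_bigl (fun v => v \in f @: ~: t)); last first.
  move=> v; apply/andP/imsetP => [[vt /imsetP[u _ vE]]|[u ut ->]].
    by exists u => //; rewrite inE; move: vt; rewrite vE mem_imset.
  by rewrite !mem_imset // -in_setC.
rewrite big_imset /=; last by move=> ? ? _ _; exact: f_inj.
apply: eq_big => [u|u _]; first by rewrite in_setC.
rewrite sgn_imset ffunE -imsetU1 preimK ifT //.
by rewrite imsetS ?subsetT.
Qed.

Lemma acyclic_relabel D n :
  acyclic K r (im_complex D) n <-> acyclic K (r \o f) D n.
Proof.
have push0 : push 0 = 0 by apply/ffunP=> s; rewrite !ffunE if_same.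
have pull0 : pull 0 = 0 by apply/ffunP=> s; rewrite !ffunE.
split=> acy c Dc cC.
- have [||b Db bE] := acy (push c); first exact: push_supported.
    by rewrite bnd_push cC push0.
  exists (pull b); first exact: pull_supported.
  by rewrite -[LHS]pullK -bnd_push (pushK Db) bE pullK.
- have [||b Db bE] := acy (pull c); first exact: pull_supported.
    by rewrite -[LHS]pullK -bnd_push (pushK Dc) cC pull0.
  by exists (push b); [exact: push_supported | rewrite bnd_push bE (pushK Dc)].
Qed.

End Relabel.

(** * Comparison of chains with the boundary matrices *)

Definition vrank (T : finType) (v : T) : nat := enum_rank v.

Lemma vrank_inj (T : finType) : injective (@vrank T).
Proof. by move=> u v /ord_inj/enum_rank_inj. Qed.

Section Matrices.
Variables (K : fieldType) (T : finType).
Implicit Types (s t : {set T}) (D : {set {set T}}) (c : {ffun {set T} -> K}).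

Local Notation vrank := (@vrank T).

Lemma bdcoefU1 t v : v \notin t -> bdcoef K (v |: t) t = sgn K vrank t v.
Proof.
move=> vt; rewrite /bdcoef subsetUr cardsU1 vt eqxx /=.
have -> : (v |: t) :\: t = [set v].
  by apply/setP=> u; rewrite !inE; case: (eqVneq u v) => [->|_]; rewrite ?vt ?andNb.
by rewrite big_set1 -sgn_self.
Qed.

Lemma bdcoef_neq0 s t : bdcoef K s t != 0 ->
  exists2 v, v \notin t & s = v |: t.
Proof.
rewrite /bdcoef; case: ifP => [/andP[ts /eqP sE] _|]; last by rewrite eqxx.
have /cards1P[v vE] : #|s :\: t| == 1%N.
  by rewrite cardsD (setIidPr ts) sE subSnn.
exists v; first by have := set11 v; rewrite -vE inE => /andP[].
by rewrite -vE setUC -{1}(setIidPr ts) setID.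
Qed.

Lemma bnd_bdcoef c t : bnd vrank c t = \sum_s bdcoef K s t * c s.
Proof.
rewrite (bigID (mem [set v |: t | v in ~: t])) /= [X in _ + X]big1 ?addr0.
  rewrite big_imset /= ?ffunE.
    by apply: eq_big => v => [|vt]; rewrite ?inE // bdcoefU1.
  move=> v w; rewrite !inE => vt wt /setP/(_ v).
  by rewrite !inE eqxx (negPf vt) !orbF => /esym/eqP.
move=> s sI; have [->|/bdcoef_neq0[v vt sE]] := eqVneq (bdcoef K s t) 0.
  by rewrite mul0r.
by case/negP: sI; apply/imsetP; exists v; rewrite ?inE.
Qed.

Definition row_of D n c : 'rV[K]_#|faces D n| := \row_i c (enum_val i).

Definition chain_of D n (u : 'rV[K]_#|faces D n|) : {ffun {set T} -> K} :=
  [ffun s : {set T} => \sum_i (enum_val i == s)%:R * u 0 i].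

Lemma chain_of_supported D n (u : 'rV[K]_#|faces D n|) :
  supported (faces D n) (chain_of u).
Proof.
move=> s sD; rewrite ffunE big1 // => i _; case: eqP => [iE|_].
  by rewrite -iE enum_valP in sD.
by rewrite mul0r.
Qed.

Lemma chain_ofK D n (u : 'rV[K]_#|faces D n|) : row_of D n (chain_of u) = u.
Proof.
apply/rowP=> i; rewrite mxE ffunE (bigD1 i) //= eqxx mul1r big1 ?addr0 // => j ji.
by rewrite (inj_eq enum_val_inj) (negPf ji) mul0r.
Qed.

Lemma row_of_inj D n c1 c2 : supported (faces D n) c1 ->
  supported (faces D n) c2 -> row_of D n c1 = row_of D n c2 -> c1 = c2.
Proof.
move=> D1 D2 /rowP cE; apply/ffunP=> s.
case: (boolP (s \in faces D n)) => sD; last by rewrite D1 ?D2.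
by have := cE (enum_rank_in sD s); rewrite !mxE enum_rankK_in.
Qed.

Lemma row_of_bnd D n c : supported (faces D n) c ->
  row_of D n c *m bd K D n = row_of D n.-1 (bnd vrank c).
Proof.
move=> Dc; apply/rowP=> j; rewrite !mxE bnd_bdcoef.
rewrite [RHS](bigID (mem (faces D n))) /= [X in _ + X]big1 ?addr0; last first.
  by move=> s sD; rewrite Dc ?mulr0.
by rewrite [RHS]big_enum_val; apply: eq_bigr => i _; rewrite !mxE mulrC.
Qed.

Lemma acyclicP D n : downset D ->
  reflect (acyclic K vrank D n) (~~ redH_nonzero K D n).
Proof.
move=> dD; rewrite /redH_nonzero negbK; apply: (iffP idP) => [kerB c Dc cC|acy].
- have: (row_of D n c <= kermx (bd K D n))%MS.
    apply/sub_kermxP; rewrite row_of_bnd // cC.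
    by apply/rowP=> j; rewrite !mxE ffunE.
  move/submx_trans/(_ kerB)/submxP=> [u uE].
  exists (chain_of u); first exact: chain_of_supported.
  apply: (@row_of_inj D n) => //.
    exact/bnd_supported/chain_of_supported.
  rewrite uE -{2}[u]chain_ofK row_of_bnd //; exact: chain_of_supported.
- apply/row_subP=> i; have: row i (kermx (bd K D n)) *m bd K D n = 0.
    by rewrite -row_mul mulmx_ker row0.
  move: (row i _) => u uK; have uS := chain_of_supported u.
  have [||b Db bE] := acy (chain_of u) => //.
    (* For size 0 the index [n.-1] is again 0, so the matrix does not encode the boundary; a chain
       on the empty face is a cycle anyway. *)
    case: n u uK uS {acy i} => [|n] u uK uS; first exact: bnd_faces0 uS.
    apply: (@row_of_inj D n); [exact: bnd_supported| exact: supported0 |].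
    rewrite -(row_of_bnd uS) chain_ofK uK.
    by apply/rowP=> j; rewrite !mxE ffunE.
  by rewrite -[u]chain_ofK -bE -(row_of_bnd Db) submxMl.
Qed.

(** This shows that the bounded maximum defining [reg] misses no degree. *)
Lemma redH_nonzero_leq D n : redH_nonzero K D n -> (n <= #|T|)%N.
Proof.
apply: contraTT; rewrite -ltnNge /redH_nonzero negbK => Tn.
apply/row_subP=> -[i Hi]; exfalso; move: Hi.
rewrite (_ : faces D n = set0) ?cards0 //; apply/setP=> s; rewrite !inE.
by apply/negP=> /andP[_ /eqP sn]; move: (max_card (mem s)); rewrite sn leqNgt Tn.
Qed.

End Matrices.

(** * Homology of independence complexes *)

Section Independence.
Variables (K : fieldType) (T : finType).
Implicit Types (e : rel T) (S s : {set T}) (D : {set {set T}}).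

Lemma redH_toggle D E v n : downset D -> downset E -> D \subset E ->
  (forall s, s \in E :\: D -> (v |: s \in E :\: D) && (s :\ v \in E :\: D)) ->
  redH_nonzero K D n = redH_nonzero K E n.
Proof.
move=> dD dE DE tog; apply: negb_inj.
have [] := toggle_acyclic K (@vrank_inj T) dD dE DE tog n => DtoE EtoD.
by apply/(acyclicP K n dD)/(acyclicP K n dE).
Qed.

Lemma IndP e S s :
  reflect (s \subset S /\ forall u v, u \in s -> v \in s -> ~~ e u v)
          (s \in Ind e S).
Proof.
rewrite inE; apply: (iffP andP) => -[sS H]; split=> //.
  by move=> u v us vs; move/'forall_in_'forall_in_idP: H; apply.
by apply/'forall_in_'forall_in_idP => u us v vs; apply: H.
Qed.

Lemma Ind_downset e S : downset (Ind e S).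
Proof.
move=> s t /subsetP ts /IndP[sS H]; apply/IndP; split.
  by apply: subset_trans sS; apply/subsetP.
by move=> u v /ts us /ts vs; apply: H.
Qed.

Lemma deletion_Ind e S v : deletion (Ind e S) v = Ind e (S :\ v).
Proof.
apply/setP=> s; rewrite inE; apply/andP/IndP => [[/IndP[sS H] vs]|[sS H]].
  by rewrite subsetD1 sS.
by move: sS; rewrite subsetD1 => /andP[sS vs]; split=> //; apply/IndP.
Qed.

Lemma link_Ind e S v : simple_graph e -> v \in S ->
  link (Ind e S) v = Ind e (S :\: cnbhd e v).
Proof.
move=> [sym irr] vS; apply/setP=> s; rewrite inE.
apply/andP/IndP => [[vs /IndP[sS H]]|[sS H]].
  split; last by move=> a b sa sb; apply: H; rewrite inE ?sa ?sb orbT.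
  apply/subsetP=> a sa; rewrite !inE negb_or H ?setU11 ?inE ?sa ?orbT //.
  rewrite (subsetP sS) ?inE ?sa ?orbT // !andbT.
  by apply: contraNneq vs => <-.
have sv a : a \in s -> [/\ a != v, ~~ e v a & a \in S].
  by move/(subsetP sS); rewrite !inE negb_or -andbA => /and3P[].
split; first by apply/negP=> /sv[]; rewrite eqxx.
apply/IndP; split.
  by rewrite subUset sub1set vS; apply/subsetP=> a /sv[].
move=> a b /setU1P[->|sa] /setU1P[->|sb]; rewrite ?irr //.
- by case: (sv b sb).
- by rewrite sym; case: (sv a sa).
- exact: H.
Qed.

(** An isolated vertex can be toggled in every face, so the complex compares with [set0], which
    lacks even the empty face and hence has no homology at all. *)
Lemma redH_cone e S v n : simple_graph e -> v \in S ->
  (forall u, u \in S -> ~~ e v u) -> redH_nonzero K (Ind e S) n = false.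
Proof.
move=> [sym irr] vS vN; rewrite -(@redH_toggle set0 _ v).
- apply/negbTE/acyclicP => [s t _|c cS _]; first by rewrite inE.
  exists 0; first exact: supported0.
  by rewrite bnd0; apply/ffunP=> s; rewrite ffunE cS // !inE.
- by move=> s t _; rewrite inE.
- exact: Ind_downset.
- exact: sub0set.
- move=> s; rewrite !setD0 => sI; apply/andP; split.
    case/IndP: sI => sS H; apply/IndP; split; first by rewrite subUset sub1set vS.
    move=> a b /setU1P[->|sa] /setU1P[->|sb]; rewrite ?irr //.
    + by apply/vN/(subsetP sS).
    + by rewrite sym; apply/vN/(subsetP sS).
    + exact: H.
  by apply: Ind_downset sI; apply: subsetDl.
Qed.

Lemma redH_del_link e S v n : simple_graph e -> v \in S ->
  redH_nonzero K (Ind e S) n.+1 ->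
  redH_nonzero K (Ind e (S :\ v)) n.+1 ||
  redH_nonzero K (Ind e (S :\: cnbhd e v)) n.
Proof.
move=> ge vS; rewrite -deletion_Ind -link_Ind //; apply: contraTT; rewrite negb_or.
case/andP; rewrite deletion_Ind link_Ind //.
move=> /(acyclicP _ _ (@Ind_downset _ _)) Ad /(acyclicP _ _ (@Ind_downset _ _)) Al.
apply/(acyclicP _ _ (@Ind_downset _ _)).
apply: (@acyclic_of_deletion_link _ _ _ (@vrank_inj T) _ v).
- exact: Ind_downset.
- by rewrite deletion_Ind.
- by rewrite link_Ind.
Qed.

Lemma redH_of_del e S v n : simple_graph e -> v \in S ->
  redH_nonzero K (Ind e (S :\ v)) n ->
  redH_nonzero K (Ind e S) n || redH_nonzero K (Ind e (S :\: cnbhd e v)) n.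
Proof.
move=> ge vS; apply: contraTT; rewrite negb_or.
case/andP=> /(acyclicP _ _ (@Ind_downset _ _)) AS /(acyclicP _ _ (@Ind_downset _ _)) Al.
apply/(acyclicP _ _ (@Ind_downset _ _)); rewrite -deletion_Ind.
apply: (@acyclic_deletion _ _ _ (@vrank_inj T)) => //; first exact: Ind_downset.
by rewrite link_Ind.
Qed.

Lemma redH_of_link e S v n : simple_graph e -> v \in S ->
  redH_nonzero K (Ind e (S :\: cnbhd e v)) n ->
  redH_nonzero K (Ind e S) n.+1 || redH_nonzero K (Ind e (S :\ v)) n.
Proof.
move=> ge vS; apply: contraTT; rewrite negb_or.
case/andP=> /(acyclicP _ _ (@Ind_downset _ _)) AS /(acyclicP _ _ (@Ind_downset _ _)) Ad.
apply/(acyclicP _ _ (@Ind_downset _ _)); rewrite -link_Ind //.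
apply: (@acyclic_link _ _ _ (@vrank_inj T)) => //; first exact: Ind_downset.
by rewrite deletion_Ind.
Qed.

End Independence.

(** The enumeration of [T'] need not be the one pulled back from [T] along [f], hence the change of
    order in both directions. *)
Lemma redH_relabel (K : fieldType) (T T' : finType) (f : T' -> T)
    (e : rel T) (e' : rel T') (S : {set T'}) n : injective f ->
  (forall a b, e' a b = e (f a) (f b)) ->
  redH_nonzero K (Ind e' S) n = redH_nonzero K (Ind e (f @: S)) n.
Proof.
move=> f_inj ee'.
have imE : im_complex f (Ind e' S) = Ind e (f @: S).
  apply/setP=> s; apply/imsetP/IndP => [[t /IndP[tS H] ->]|[sS H]].
    split; first exact: imsetS.
    by move=> _ _ /imsetP[a ta ->] /imsetP[b tb ->]; rewrite -ee' H.
  have sT : s \subset f @: setT by apply: subset_trans sS _; rewrite imsetS ?subsetT.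
  exists (f @^-1: s); last by rewrite sub_imsetT.
  apply/IndP; split; last by move=> a b; rewrite !inE ee'; apply: H.
  by apply/subsetP=> a; rewrite inE => /(subsetP sS); rewrite mem_imset.
have fr_inj : injective (@vrank T \o f) by apply: inj_comp f_inj; apply: vrank_inj.
apply: negb_inj; rewrite -imE.
have dI : downset (im_complex f (Ind e' S)) by rewrite imE; apply: Ind_downset.
have [imP Pim] := acyclic_relabel K (@vrank T) f_inj (Ind e' S) n.
apply/(acyclicP K n (@Ind_downset _ e' S))/(acyclicP K n dI).
- by move/(acyclic_rank (@vrank_inj T') fr_inj)/Pim.
- by move/imP/(acyclic_rank fr_inj (@vrank_inj T')).
Qed.

(** Only positive indices matter, since index 0 adds nothing to the maximum. *)
Lemma reg_leq (K : fieldType) (T T' : finType) (e : rel T) (e' : rel T') :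
  (forall S n, redH_nonzero K (Ind e S) n.+1 ->
     exists S', redH_nonzero K (Ind e' S') n.+1) ->
  (reg K e <= reg K e')%N.
Proof.
move=> H; apply/bigmax_leqP => -[[|n] //= nT] /existsP[S /H[S' nz]].
have n2 : (n.+1 < #|T'|.+2)%N by apply/leqW/(redH_nonzero_leq nz).
by apply: (@leq_bigmax_cond _ _ _ (Ordinal n2)); apply/existsP; exists S'.
Qed.

(** * Merging a pair inside the original vertex set *)

Section Pair.
Variables (K : fieldType) (T : finType) (e : rel T) (x y : T).
Hypotheses (ge : simple_graph e) (xy : x != y) (exy : ~~ e x y).
Implicit Types (S s : {set T}).

(* [g(G;xy)] realised on the vertex set of [G], with [x] playing the role of [w];
   only its restriction to the complement of [y] is isomorphic to [g(G;xy)]. *)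
Definition merge_rel : rel T := fun a b =>
  if a == x then e x b && e y b
  else if b == x then e x a && e y a else e a b.

Lemma merge_relE a b : a != x -> b != x -> merge_rel a b = e a b.
Proof. by rewrite /merge_rel => /negPf-> /negPf->. Qed.

Lemma merge_rel_simple : simple_graph merge_rel.
Proof.
case: ge => sym irr; split=> [a b|a]; rewrite /merge_rel.
  by case: (eqVneq a x) => [->|_]; case: (eqVneq b x) => // ->.
by case: eqP => [->|_]; rewrite irr.
Qed.

Lemma sub_merge_rel a b : merge_rel a b -> e a b.
Proof.
case: ge => sym irr; rewrite /merge_rel; case: eqP => [->|_]; first by case/andP.
by case: eqP => // ->; rewrite sym => /andP[].
Qed.

Lemma Ind_merge_rel S : x \notin S -> Ind merge_rel S = Ind e S.
Proof.
move=> xS; apply/setP=> s; apply/IndP/IndP => -[sS H]; split=> // u v us vs.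
all: have ux : u != x by apply: contraNneq xS => <-; apply: (subsetP sS).
all: have vx : v != x by apply: contraNneq xS => <-; apply: (subsetP sS).
all: by have := H u v us vs; rewrite merge_relE.
Qed.

(** Neighbours of [x] in the merged relation are also neighbours of [y], so [x] can be toggled in
    every face containing [y]. *)
Lemma redH_merge_remove S n : x \in S -> y \in S ->
  redH_nonzero K (Ind merge_rel (S :\ y)) n = redH_nonzero K (Ind merge_rel S) n.
Proof.
move=> xS yS; case: ge => sym irr; case: merge_rel_simple => sym2 irr2.
apply: (@redH_toggle _ _ _ _ x); try exact: Ind_downset.
  by rewrite -deletion_Ind; apply: deletion_sub.
have DE s : (s \in Ind merge_rel S :\: Ind merge_rel (S :\ y)) =
            (y \in s) && (s \in Ind merge_rel S).
  rewrite -deletion_Ind in_setD [in X in ~~ X]inE negb_and negbK.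
  by case: (s \in Ind _ _); rewrite ?andbF ?orbF.
move=> s; rewrite !DE => /andP[ys sI]; have /IndP[sS H] := sI.
apply/andP; split; apply/andP; split.
- by rewrite inE ys orbT.
- apply/IndP; split; first by rewrite subUset sub1set xS.
  have xN b : b \in s -> ~~ merge_rel x b.
    move=> bs; have [->|bx] := eqVneq b x; first by rewrite irr2.
    have := H y b ys bs; rewrite merge_relE // 1?eq_sym // /merge_rel eqxx.
    by rewrite negb_and => ->; rewrite orbT.
  move=> u v /setU1P[->|us] /setU1P[->|vs]; rewrite ?irr2 //; first exact: xN.
    by rewrite sym2; apply: xN.
  exact: H.
- by rewrite !inE ys eq_sym xy.
- by apply: Ind_downset sI; apply: subsetDl.
Qed.

Hypothesis cross : forall a b,
  e x a -> ~~ e y a -> e y b -> ~~ e x b -> e a b.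

(* A face of the right-hand complex missing on the left contains [x] and a private
   neighbour [a] of [x]; as [a] sees every private neighbour of [y], the face stays
   independent when [y] is added. *)
Lemma redH_merge S n : x \in S -> y \in S ->
  redH_nonzero K (Ind e S) n = redH_nonzero K (Ind merge_rel S) n.
Proof.
move=> xS yS; case: ge => sym irr; case: merge_rel_simple => sym2 irr2.
apply: (@redH_toggle _ _ _ _ y); try exact: Ind_downset.
  apply/subsetP=> s /IndP[sS H]; apply/IndP; split=> // u v us vs.
  by apply: contra (H u v us vs); apply: sub_merge_rel.
move=> s /setDP[sI sN]; have /IndP[sS H] := sI.
(* The only edges lost by merging join [x] to its private neighbours, so a face that is not
   independent in [e] contains one of them. *)
have [a [xs as_ xa ya]] : exists a, [/\ x \in s, a \in s, e x a & ~~ e y a].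
  have /existsP[u /existsP[v /and3P[us vs uv]]] :
      [exists u, exists v, [&& u \in s, v \in s & e u v]].
    apply: contraR sN => /existsPn nE; apply/IndP; split=> // u v us vs.
    by have /existsPn/(_ v) := nE u; rewrite us vs.
  have := H u v us vs; rewrite /merge_rel.
  case: eqP => [ux|_]; first by subst u; rewrite uv /= => yv; exists v.
  case: eqP => [vx|_]; last by rewrite uv.
  by subst v; rewrite sym in uv; rewrite uv /= => yu; exists u.
have ay : a != y by apply: contraTneq xa => ->.
have ax : a != x by apply: contraTneq xa => ->; rewrite irr.
have out (t : {set T}) : x \in t -> a \in t -> t \notin Ind e S.
  by move=> xt at_; apply/negP=> /IndP[_ /(_ x a xt at_)]; rewrite xa.
apply/andP; split; apply/setDP; split.
- apply/IndP; split; first by rewrite subUset sub1set yS.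
  have yN b : b \in s -> ~~ merge_rel y b.
    move=> bs; apply/negP; have [->|bx] := eqVneq b x.
      by rewrite sym2 /merge_rel eqxx irr andbF.
    rewrite merge_relE // 1?eq_sym // => yb.
    have := H x b xs bs; rewrite {1}/merge_rel eqxx yb andbT => xb.
    by have := H a b as_ bs; rewrite merge_relE // (cross xa ya yb xb).
  move=> u v /setU1P[->|us] /setU1P[->|vs]; rewrite ?irr2 //; first exact: yN.
    by rewrite sym2; apply: yN.
  exact: H.
- by apply: out; rewrite inE ?xs ?as_ orbT.
- by apply: Ind_downset sI; apply: subsetDl.
- by apply: out; rewrite !inE ?xs ?as_ ?xy ?ay.
Qed.

End Pair.

(* If neither [S + y] nor [S - x - N(y)] carries the class, exactness moves it one
   degree down to [W = S - N(y) - N[x]]; the vertex [u] sees nothing of [W], so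
   adding the path [x - u - y] suspends [Ind W] and restores the degree. *)
Lemma redH_both_or_neither (K : fieldType) (T : finType) (e : rel T) (x y u : T)
    (S : {set T}) n :
  simple_graph e -> x != y -> ~~ e x y -> e x u -> e y u ->
  cnbhd e u \subset cnbhd e x :|: cnbhd e y ->
  x \in S -> y \notin S -> redH_nonzero K (Ind e S) n.+1 ->
  exists2 S' : {set T}, (x \in S') = (y \in S') & redH_nonzero K (Ind e S') n.+1.
Proof.
move=> ge xy exy xu yu Nu xS yS; case: (ge) => sym irr.
(* [S] is viewed as the deletion of [y] from [y |: S]. *)
rewrite -(setU1K yS) => /(redH_of_del ge (setU11 _ _))/orP[nz|].
  by exists (y |: S); rewrite // setU11 inE xS orbT.
set S1 := _ :\: cnbhd e y => nz1.
have xS1 : x \in S1 by rewrite !inE xS orbT negb_or xy sym exy.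
have yS1 : y \notin S1 by rewrite !inE eqxx.
have /orP[nz|] := redH_del_link ge xS1 nz1.
  by exists (S1 :\ x); rewrite // !inE !eqxx /= andbF.
set W := S1 :\: cnbhd e x => nzW.
set S2 := u |: (x |: (y |: W)).
have uS2 : u \in S2 by apply: setU11.
have ux : u != x by apply: contraTneq xu => ->; rewrite irr.
have uy : u != y by apply: contraTneq yu => ->; rewrite irr.
(* [W] avoids the closed neighbourhoods of [x] and [y], which together cover that of [u]. *)
have WE : S2 :\: cnbhd e u = W.
  apply/setP=> z; rewrite in_setD; apply/andP/idP => [[zu]|zW].
    move: zu; rewrite !inE negb_or => /andP[/negPf-> zu] /=.
    by case/or3P=> // /eqP zE; move: zu; rewrite zE sym ?xu ?yu.
  split; last by rewrite !in_setU zW !orbT.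
  apply/negP => /(subsetP Nu) /setUP[] zN; move: zW; rewrite in_setD ?zN //.
  by rewrite in_setD zN /= andbF.
have [xS2 yS2] : x \in S2 /\ y \in S2 by rewrite !inE !eqxx !orbT.
have /orP[nz|] : redH_nonzero K (Ind e S2) n.+1 || redH_nonzero K (Ind e (S2 :\ u)) n.
- by apply: redH_of_link; rewrite ?WE.
- by exists S2; rewrite ?xS2 ?yS2.
(* Once [u] is removed, [x] has no neighbour left, so the deletion is a cone. *)
rewrite (@redH_cone _ _ _ _ x) //; first by rewrite !inE eq_sym ux eqxx orbT.
move=> z; rewrite !inE => /andP[/negPf-> /=] /or3P[/eqP->|/eqP->//|].
  by rewrite irr.
by rewrite negb_or -andbA => /and4P[].
Qed.

(** Otherwise the edges [x a] and [y b] would form an induced pair of disjoint edges. *)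
Lemma genuine_pair_cross (T : finType) (e : rel T) (x y a b : T) :
  simple_graph e -> genuine_pair e x y ->
  e x a -> ~~ e y a -> e y b -> ~~ e x b -> e a b.
Proof.
move=> [sym irr] [xy [exy no2K2]] xa ya yb xb; apply: contraT => ab.
have ax : a != x by apply: contraTneq xa => ->; rewrite irr.
have ay : a != y by apply: contraTneq xa => ->.
have bx : b != x by apply: contraTneq yb => ->; rewrite sym.
have bY : b != y by apply: contraTneq yb => ->; rewrite irr.
have nab : a != b by apply: contraNneq ya => ->.
case: (no2K2 a b); rewrite ?inE ?negb_or ?ax ?ay ?bx ?bY //; split.
  rewrite -!setUA !cardsU1 cards1 !inE !negb_or xy nab.
  by rewrite ![_ == a]eq_sym ![_ == b]eq_sym ax ay bx bY.
exists x, a, y, b; split; first by rewrite (setUAC [set x] [set y]).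
by rewrite (sym a y).
Qed.

(** * Equality of the regularities *)

Theorem mainTheorem16 (K : fieldType) (T : finType) (e : rel T) (x y : T) :
  simple_graph e -> true_pair e x y ->
  reg K e = reg K (gedge e x y).
Proof.
move=> ge [gp [u [uN Nu]]]; have [sym irr] := ge; have [xy [exy _]] := gp.
have cross a b := @genuine_pair_cross T e x y a b ge gp.
move: uN; rewrite !inE => /andP[xu yu].
(* The new vertex [w] is sent to [x], so the image is everything except [y]. *)
pose f (a : option {v : T | (v != x) && (v != y)}) : T :=
  if a is Some a' then val a' else x.
have fx a : (val (a : {v : T | (v != x) && (v != y)}) == x) = false.
  by case/andP: (valP a) => /negPf.
have f_inj : injective f.
  move=> [a|] [b|] //= => [/val_inj->//|/eqP|/esym/eqP]; by rewrite fx.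
have fE a b : gedge e x y a b = merge_rel e x y (f a) (f b).
  by case: a b => [a|] [b|] /=; rewrite /merge_rel ?eqxx ?fx ?irr.
have im_f (S : {set T}) : y \notin S -> S \subset f @: setT.
  move=> yS; apply/subsetP=> v vS; apply/imsetP.
  have [->|vx] := eqVneq v x; first by exists None.
  have vy : v != y by apply: contraNneq yS => <-.
  have v_ok : (v != x) && (v != y) by rewrite vx vy.
  by exists (Some (exist _ v v_ok)).
have y_im (S : {set option {v : T | (v != x) && (v != y)}}) : y \notin f @: S.
  apply/imsetP=> -[[a|] _ /= /esym/eqP]; last by rewrite (negPf xy).
  by case/andP: (valP a) => _ /negPf->.
apply/eqP; rewrite eqn_leq; apply/andP; split; apply: reg_leq => S n nz.
- have [S' xyS' {}nz] : exists2 S' : {set T},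
      (x \in S') = (y \in S') & redH_nonzero K (Ind e S') n.+1.
    have [xS|xS] := boolP (x \in S); have [yS|yS] := boolP (y \in S).
    + by exists S; rewrite ?xS ?yS.
    + exact: (redH_both_or_neither ge xy exy xu yu Nu xS yS nz).
    (* The same trade with [x] and [y] exchanged. *)
    + have [] := redH_both_or_neither ge _ _ yu xu _ yS xS nz.
      * by rewrite eq_sym.
      * by rewrite sym.
      * by rewrite setUC.
      * by move=> S' yxS' nz'; exists S'.
    + by exists S; rewrite ?(negPf xS) ?(negPf yS).
  exists (f @^-1: (S' :\ y)).
  rewrite (redH_relabel K _ _ f_inj fE) sub_imsetT; last by rewrite im_f // !inE eqxx.
  (* With both vertices present, merging and then dropping [y] preserves homology; with neither, the
     two relations agree on [S']. *)
  have [yS'|yS'] := boolP (y \in S').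
    by rewrite redH_merge_remove ?xyS' // -redH_merge ?xyS'.
  have yD : S' :\ y = S' by apply/setDidPl; rewrite disjoint_sym disjoints1.
  by rewrite yD Ind_merge_rel // xyS'.
- move: nz; rewrite (redH_relabel K _ _ f_inj fE).
  have := y_im S; move: (f @: S) => S' yS' nz.
  have [xS'|xS'] := boolP (x \in S'); last first.
    by exists S'; rewrite -(Ind_merge_rel _ y xS').
  (* A set containing the image [x] of [w] corresponds to one containing both [x] and [y]. *)
  exists (y |: S'); rewrite (redH_merge K ge xy exy cross) ?setU11 // ?inE ?xS' ?orbT //.
  by rewrite -redH_merge_remove ?setU11 ?setU1K // !inE xS' orbT.
Qed.
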